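(* Let $T>0$, $0\le t_0<t_1\le T$, $\Delta t=t_1-t_0$, let $n\ge 3$, $h=\frac{2}{n-1}$, and let $x_i=-1+(i-1)h$, $i=1,\dots,n$, be the uniform grid on $[-1,1]$. Let $u$ be the exact solution of $$u_t(x,t)=f(x)u_{xx}(x,t),\quad x\in[-1,1],\ t\in(0,T],\qquad u(\pm1,t)=\varphi_{\pm1}(t),\quad u(x,0)=u_0(x),$$ and write $u_{0i}=u(x_i,t_0)$, $u_{1i}=u(x_i,t_1)$. Let the observed data be $$U_{0i}=u_{0i}+\mathbf{W}_{0i},\qquad U_{1i}=u_{1i}+\mathbf{W}_{1i},\qquad i=1,\dots,n,$$ with noise vectors $\mathbf{W}_0,\mathbf{W}_1\in\mathbb{R}^n$. Let $f_\theta:\mathbb{R}\to\mathbb{R}$ be a dense $\tanh$ neural network whose parameters satisfy the uniform parameter bound (both as defined in the context). Assume: 1. (Observation error) there is $\varepsilon_o>0$ with $\|\mathbf{W}_0\|_\infty\le\varepsilon_o$ and $\|\mathbf{W}_1\|_\infty\le\varepsilon_o$. 2. (Optimization error) there is $\varepsilon_{opt}>0$ such that for all $i=2,\dots,n-1$, $$\left|\frac{U_{1i}-U_{0i}}{\Delta t}-f_\theta(x_i)\frac{U_{1,i+1}+U_{1,i-1}-2U_{1i}}{2h^2}-f_\theta(x_i)\frac{U_{0,i+1}+U_{0,i-1}-2U_{0i}}{2h^2}\right|\le\varepsilon_{opt}.$$ 3. $F_0,F_2>0$ are constants such that $|f_\theta(x)|\le F_0$ and $|f_\theta''(x)|\le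 F_2$ for all $x\in[-1,1]$. 4. $u\in C^4([-1,1]\times[t_0,t_1])$, and with $$\delta_2=\min_{(x,t)\in[-1,1]\times[t_0,t_1]}|u_{xx}(x,t)|,\qquad \delta_4=\max_{(x,t)\in[-1,1]\times[t_0,t_1]}|u_{xxxx}(x,t)|,$$ one has $\delta_2>0$. Moreover $f\in C^2([-1,1])$, and $F_2^f=\max_{x\in[-1,1]}|f''(x)|$. 5. $h<\sqrt{6\delta_2/\delta_4}$ (no restriction if $\delta_4=0$). Let $C_1>0$ be the consistency constant of the Crank–Nicolson scheme defined in the context. Then for all $x\in[-1+h,1-h]$, $$|f_\theta(x)-f(x)|\le\frac{2C_1}{\delta_2}\Delta t^2+\left(\frac{2C_1}{\delta_2}+\frac{F_2+F_2^f}{2}\right)h^2+\frac{2}{\delta_2}\varepsilon_{opt}+\frac{4}{\delta_2}\left(\frac{1}{\Delta t}+\frac{2F_0}{h^2}\right)\varepsilon_o .$$ In other words, $$|f_\theta(x)-f(x)|=\mathcal{O}\left(\Delta t^2+h^2+\varepsilon_{opt}+\left(\frac1{\Delta t}+\frac1{h^2}\right)\varepsilon_o\right).$$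
   Context: Neural network: $f_\theta$ with parameters $\theta=\{\mathbf{W}_1,\dots,\mathbf{W}_{n_l},\mathbf{b}_1,\dots,\mathbf{b}_{n_l}\}$ (real weight matrices and bias vectors of compatible sizes, scalar input and scalar output; these weight matrices are not to be confused with the noise vectors $\mathbf{W}_0,\mathbf{W}_1$ of the data) is defined by $$\mathbf{y}_2=\tanh(\mathbf{W}_1 x+\mathbf{b}_1),\qquad \mathbf{y}_{i+1}=\tanh(\mathbf{W}_i\mathbf{y}_i+\mathbf{b}_i)\ \ (i=2,\dots,n_l-1),\qquad f_\theta(x)=\mathbf{W}_{n_l}\mathbf{y}_{n_l}+\mathbf{b}_{n_l},$$ with $\tanh$ applied componentwise. Uniform parameter bound: there is a constant $C>0$ such that the weights of the network satisfy $\|\mathbf{W}_i\|_2\le C$ for $i=1,\dots,n_l$, and $\|\mathbf{b}_{n_l}\|_2\le C$ (spectral norm for matrices, Euclidean norm for vectors). Under this bound, constants $F_0,F_2$ as in hypothesis 3 exist. Consistency constant: $C_1>0$ is a constant bounding the local error of the Crank–Nicolson scheme on the exact solution, i.e. for all $i=2,\dots,n-1$, $$\left|\frac{u_{1i}-u_{0i}}{\Delta t}-f(x_i)\frac{u_{1,i+1}+u_{1,i-1}-2u_{1i}}{2h^2}-f(x_i)\frac{u_{0,i+1}+u_{0,i-1}-2u_{0i}}{2h^2}\right|\le\varepsilon_c\le C_1(\Delta t^2+h^2).$$ In the $\mathcal{O}$ statement the implied constant depends only on $C_1,\delta_2,F_0,F_2,F_2^f$. *)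

(* Defs.v *)
From HB Require Import structures.
From mathcomp Require Import all_boot all_order all_algebra.
From mathcomp Require Import all_classical all_reals all_analysis.

Set Implicit Arguments.
Unset Strict Implicit.
Unset Printing Implicit Defensive.

Import Order.TTheory GRing.Theory Num.Theory numFieldNormedType.Exports.

Local Open Scope classical_set_scope.
Local Open Scope ring_scope.

Definition is_min (R : realType) (S : set R) (m : R) : Prop := S m /\ lbound S m.

Definition is_max (R : realType) (S : set R) (m : R) : Prop := S m /\ ubound S m.

(* The library's [derive] is two-sided, hence says nothing usable at the
   endpoints of a closed interval.  The derivatives below are relative to a set
   [A] (the limit is taken along [A]): two-sided at interior points of [A] and
   one-sided at the endpoints of an interval. *)
Definition slope (R : realType) (g : R -> R) (a y : R) : R :=
  (g y - g a) / (y - a).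

Definition derivable_in (R : realType) (A : set R) (g : R -> R) (a : R) : Prop :=
  cvg (slope g a y @[y --> within A a^']).

Definition derive_in (R : realType) (A : set R) (g : R -> R) (a : R) : R :=
  lim (slope g a y @[y --> within A a^']).

Definition dx (R : realType) (I : set R) (u : R -> R -> R) : R -> R -> R :=
  fun x t => derive_in I (u^~ t) x.

Definition dt (R : realType) (J : set R) (u : R -> R -> R) : R -> R -> R :=
  fun x t => derive_in J (u x) t.

Fixpoint class_C (R : realType) (k : nat) (I : set R) (g : R -> R) : Prop :=
  {within I, continuous g} /\
  if k is k'.+1 then
    (forall x, I x -> derivable_in I g x) /\ class_C k' I (derive_in I g)
  else True.

(* C^k on [I `*` J]: every (pure or mixed) partial derivative of order at most
   [k] exists on all of [I `*` J] and is jointly continuous there. *)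
Fixpoint class_C2 (R : realType) (k : nat) (I J : set R) (u : R -> R -> R) : Prop :=
  {within I `*` J, continuous (fun p : R * R => u p.1 p.2)} /\
  if k is k'.+1 then
    [/\ forall x t, I x -> J t -> derivable_in I (u^~ t) x,
        forall x t, I x -> J t -> derivable_in J (u x) t,
        class_C2 k' I J (dx I u) &
        class_C2 k' I J (dt J u)]
  else True.

(* Classical solutions; the time derivative at [t = T] is one-sided. *)
Definition exact_solution (R : realType) (T : R) (f phim phip uinit : R -> R)
    (u : R -> R -> R) : Prop :=
  let I : set R := `[-1, 1]%classic in
  let J : set R := `]0, T]%classic in
  [/\ forall x t, I x -> J t ->
        [/\ derivable_in J (u x) t,
            derivable_in I (u^~ t) x,
            derivable_in I (dx I u ^~ t) x &
            dt J u x t = f x * dx I (dx I u) x t],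
      forall t, J t -> u (-1) t = phim t,
      forall t, J t -> u 1 t = phip t &
      forall x, I x -> u x 0 = uinit x].

Definition tanh (R : realType) (z : R) : R :=
  (expR z - expR (- z)) / (expR z + expR (- z)).

Definition norm2 (R : realType) (m : nat) (v : 'cV[R]_m) : R :=
  Num.sqrt (\sum_(i < m) v i 0 ^+ 2).

Definition spectral_norm (R : realType) (m p : nat) (A : 'M[R]_(m, p)) : R :=
  sup [set norm2 (A *m v) | v in [set v : 'cV[R]_p | norm2 v <= 1]].

(* Parameters of a network with [n_l = nhid.+2 >= 2] affine layers and hidden
   vectors y_2, ..., y_{n_l} of sizes [width 0], ..., [width nhid].  In the
   numbering W_1, ..., W_{n_l} of the weights, [Win] is W_1, [Whid j] is
   W_{j+2} for [j < nhid], and [Wout] is W_{n_l}; likewise for the biases.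
   [Whid j], [bhid j] with [j >= nhid] and [width j] with [j > nhid] play no
   role. *)
Record network (R : realType) := Network {
  nhid : nat;
  width : nat -> nat;
  width_gt0 : forall j, (0 < width j)%N;
  Win : 'M[R]_(width 0, 1);
  bin : 'cV[R]_(width 0);
  Whid : forall j, 'M[R]_(width j.+1, width j);
  bhid : forall j, 'cV[R]_(width j.+1);
  Wout : 'M[R]_(1, width nhid);
  bout : 'cV[R]_1 }.

(* [layer theta x j] is y_{j+2}. *)
Fixpoint layer (R : realType) (theta : network R) (x : R) (j : nat) :
    'cV[R]_(width theta j) :=
  match j with
  | 0 => map_mx (@tanh R) (Win theta *m x%:M + bin theta)
  | j'.+1 =>
      map_mx (@tanh R) (Whid theta j' *m layer theta x j' + bhid theta j')
  end.

Definition eval_net (R : realType) (theta : network R) (x : R) : R :=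
  (Wout theta *m layer theta x (nhid theta) + bout theta) 0 0.

Definition params_bounded (R : realType) (theta : network R) (C : R) : Prop :=
  [/\ spectral_norm (Win theta) <= C,
      forall j, (j < nhid theta)%N -> spectral_norm (Whid theta j) <= C,
      spectral_norm (Wout theta) <= C &
      norm2 (bout theta) <= C].

Definition mesh (R : realType) (n : nat) : R := 2 / (n%:R - 1).

(* Grid indices are 0-based: [grid i] is the point x_{i+1}. *)
Definition grid (R : realType) (n : nat) (i : 'I_n) : R :=
  -1 + (i : nat)%:R * mesh R n.

Definition sample (R : realType) (n : nat) (u : R -> R -> R) (t : R) : 'rV[R]_n :=
  \row_(i < n) u (grid R i) t.

(* Crank-Nicolson residual at node [i], with left and right neighbours [l] and
   [r], diffusion coefficient [a], and data [v0], [v1] at the two times. *)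
Definition cn_residual (R : realType) (n : nat) (tau h a : R) (v0 v1 : 'rV[R]_n)
    (l i r : 'I_n) : R :=
  (v1 0 i - v0 0 i) / tau
  - a * ((v1 0 r + v1 0 l - 2 * v1 0 i) / (2 * h ^+ 2))
  - a * ((v0 0 r + v0 0 l - 2 * v0 0 i) / (2 * h ^+ 2)).

(* |residual| <= eps at all interior nodes, i.e. those having two neighbours. *)
Definition cn_residual_le (R : realType) (n : nat) (tau h : R) (g : R -> R)
    (v0 v1 : 'rV[R]_n) (eps : R) : Prop :=
  forall l i r : 'I_n, i = l.+1 :> nat -> r = i.+1 :> nat ->
    `|cn_residual tau h (g (grid R i)) v0 v1 l i r| <= eps.

(* Main.v *)
Require Import Defs.
From mathcomp Require Import all_boot all_order all_algebra.
From mathcomp Require Import all_classical all_reals all_analysis.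
From mathcomp Require Import ring lra.
Import Order.TTheory GRing.Theory Num.Theory numFieldNormedType.Exports.
Local Open Scope classical_set_scope.
Local Open Scope ring_scope.

Set Implicit Arguments.
Unset Strict Implicit.
Unset Printing Implicit Defensive.

(** Write e = ftheta - f.  Subtracting the Crank-Nicolson residual of the exact
solution from that of the noisy data leaves, at an interior node x_i,

  e(x_i) A_i = (consistency error) - (optimization error) + (noise),

where A_i is the average over the two times of the second difference quotients
of u, and the noise contributes at most 2 (1/tau + 2 F0/h^2) eps_o
([cn_coefficient_error]).  Everything then rests on dividing by A_i.  By a
double mean value argument a second difference quotient of u is exactly a value
of u_xx ([second_difference_mvt]), so A_i is the mean of two values of u_xx.
As u_xx is continuous and never zero on the rectangle it has a constant sign
there, the two values do not cancel, and |A_i| >= delta2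
([mean_second_difference_lower_bound]).

Between consecutive interior nodes e differs from its chord by at most
(F2 + F2f) h^2 / 4, again by the mean value theorem applied to e and then to e'
([between_nodes_bound]).  This needs e to be twice differentiable: f is so by
hypothesis, and the network is, by induction on its layers, because tanh is
([eval_net_twice_derivable]); a bound on [derive1n 2] alone would carry no
information, as that function is also defined where derivatives do not exist.

The resulting estimate has half the constants of the explicit bound, and bounding
each of its coefficients by their sum gives the constant of the asymptotic
form ([error_bound_explicit], [error_bound_bigO]). *)

(** * Mean value arguments for relative derivatives *)

(** At an interior point the constraint of staying in the interval is void for
small increments, which turns the relative derivative into the ordinary one and
gives access to the mean value theorem. *)
Lemma is_derive_derive_in (R : realType) (a b : R) (g : R -> R) (x : R) :
  a < x < b -> derivable_in `[a, b]%classic g x ->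
  is_derive x 1 g (derive_in `[a, b]%classic g x).
Proof.
move=> /andP[ax xb] dg.
have shift_within : (fun h : R => h + x) @ 0^' --> within `[a, b]%classic x^'.
  move=> B [e /= e0 Be].
  exists (Num.min e (Num.min (x - a) (b - x))) => /=.
    by rewrite !lt_min e0 !subr_gt0 ax xb.
  move=> h /=; rewrite sub0r normrN !lt_min => /and3P[he hxa hbx] h0.
  have [? ?] : - (x - a) < h /\ h < b - x.
    by move: hxa hbx; rewrite !ltr_norml => /andP[? _] /andP[_ ?].
  apply: Be => /=.
  - by rewrite opprD addrCA subrr addr0 normrN.
  - by rewrite -subr_eq0 addrK.
  - by rewrite in_itv /=; apply/andP; split; lra.
have quotE : (fun h : R => h^-1 *: ((g \o shift x) (h *: 1) - g x))
    = slope g x \o (fun h => h + x).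
  by apply/funext => h /=; rewrite /slope /= scaler1 addrK mulrC.
have lim_quot : h^-1 *: ((g \o shift x) (h *: 1) - g x) @[h --> 0^']
    --> derive_in `[a, b]%classic g x.
  by rewrite quotE; apply: cvg_comp shift_within dg.
apply: DeriveDef; first by apply/cvg_ex; eexists; exact: lim_quot.
exact: cvg_lim lim_quot.
Qed.

Lemma is_derive_mvt (R : realType) (g g' : R -> R) (c d : R) :
  c < d -> (forall y : R, y \in `[c, d] -> is_derive y 1 g (g' y)) ->
  exists2 y : R, y \in `]c, d[ & g d - g c = g' y * (d - c).
Proof.
move=> cd dg.
have cg : {within `[c, d], continuous g}.
  by apply: derivable_within_continuous => y /dg [].
have dg' y : y \in `]c, d[ -> is_derive y 1 g (g' y).
  move=> ycd.
  apply: dg.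
  exact: subset_itv_oo_cc ycd.
exact: MVT cd dg' cg.
Qed.

(** The second difference at x with step h is the increment over [x - h, x] of
y |-> g (y + h) - g y; the mean value theorem for that function, and then for g1
on an interval of length h, produces h^2 times an exact value of g2.  Only
continuity is required at the two extreme points, which may be the endpoints of
the domain of g. *)
Lemma second_difference_mvt (R : realType) (g g1 g2 : R -> R) (x h : R) :
  0 < h -> {within `[x - h, x + h], continuous g} ->
  (forall y : R, x - h < y < x + h -> is_derive y 1 g (g1 y)) ->
  (forall y : R, x - h < y < x + h -> is_derive y 1 g1 (g2 y)) ->
  exists2 y : R, x - h < y < x + h &
    g (x + h) + g (x - h) - 2 * g x = h ^+ 2 * g2 y.
Proof.
move=> h0 cg dg dg1.
have xhx : x - h < x by lra.
pose k y := g (y + h) - g y.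
have dk y : y \in `]x - h, x[ -> is_derive y 1 k (g1 (y + h) - g1 y).
  rewrite in_itv /= => /andP[? ?].
  have dgh : is_derive (y + h) 1 g (g1 (y + h)) by apply: dg; apply/andP; split; lra.
  have dgy : is_derive y 1 g (g1 y) by apply: dg; apply/andP; split; lra.
  apply: is_deriveB.
  rewrite -[g1 (y + h)]mulr1.
  apply: (@is_derive1_comp _ g (fun z => z + h)) => //.
  by apply: is_derive_eq; rewrite addr0.
have ck : {within `[x - h, x], continuous k}.
  move/subspace_continuousP: cg => cg.
  apply/subspace_continuousP => y; rewrite /= in_itv /= => /andP[? ?].
  apply: cvgB; last first.
    apply: cvg_trans (cg y _); last by rewrite /= in_itv /=; apply/andP; split; lra.
    apply: cvg_app; apply: within_subset.
    by move=> z /=; rewrite !in_itv /= => /andP[? ?]; apply/andP; split; lra.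
  apply: (@cvg_comp _ _ _ (fun z => z + h) g _ (within `[x - h, x + h]%classic (nbhs (y + h)))); last first.
    by apply: cg; rewrite /= in_itv /=; apply/andP; split; lra.
  move=> B [e /= e0 Be]; exists e => //= z /= zy; rewrite in_itv /= => /andP[? ?].
  apply: Be => /=.
    by rewrite (_ : y + h - (z + h) = y - z) //; ring.
  by rewrite in_itv /=; apply/andP; split; lra.
have [z + kz] := MVT xhx dk ck.
rewrite in_itv /= => /andP[? ?].
have zzh : z < z + h by lra.
have dg1z y : y \in `[z, z + h] -> is_derive y 1 g1 (g2 y).
  rewrite in_itv /= => /andP[? ?].
  by apply: dg1; apply/andP; split; lra.
have [y] := is_derive_mvt zzh dg1z.
rewrite in_itv /= => /andP[? ?] gy.
exists y; first by apply/andP; split; lra.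
move: kz; rewrite /k gy subrK (_ : z + h - z = h); last by ring.
rewrite (_ : x - (x - h) = h); last by ring.
by move=> kz; transitivity (g2 y * h * h); [rewrite -kz|]; ring.
Qed.

(** The error of linear interpolation of e at x is (x - a)(b - x)/(b - a) times
the difference of the slopes of the two chords meeting at x.  These slopes are
values of e1 at points less than b - a apart, hence differ by at most
M (b - a).  The constant 1/4 is not the optimal 1/8, but it is reached with the
mean value theorem alone. *)
Lemma between_nodes_bound (R : realType) (e e1 e2 : R -> R) (a b x E M : R) :
  a < x < b ->
  (forall y : R, a <= y <= b -> is_derive y 1 e (e1 y)) ->
  (forall y : R, a <= y <= b -> is_derive y 1 e1 (e2 y)) ->
  (forall y : R, a <= y <= b -> `|e2 y| <= M) ->
  `|e a| <= E -> `|e b| <= E -> `|e x| <= E + M / 4 * (b - a) ^+ 2.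
Proof.
move=> /andP[ax xb] de de1 e2M ea eb.
have mvt (g g' : R -> R) c d : a <= c -> c < d -> d <= b ->
    (forall y : R, a <= y <= b -> is_derive y 1 g (g' y)) ->
    exists2 y : R, c < y < d & g d - g c = g' y * (d - c).
  move=> ac cd db dg.
  have dgcd y : y \in `[c, d] -> is_derive y 1 g (g' y).
    rewrite in_itv /= => /andP[? ?].
    by apply: dg; apply/andP; split; lra.
  have [y] := is_derive_mvt cd dgcd.
  by rewrite in_itv /= => ? ?; exists y.
have [y1 /andP[? ?] ex] := mvt _ _ _ _ (lexx a) ax (ltW xb) de.
have [y2 /andP[? ?] ebx] := mvt _ _ _ _ (ltW ax) xb (lexx b) de.
have [||| y3 /andP[? ?] e12] := mvt e1 e2 y1 y2 _ _ _ de1; try by lra.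
have M0 : 0 <= M by apply: le_trans (e2M x _); [exact: normr_ge0|lra].
have chord : (b - a) * e x =
    (b - x) * e a + (x - a) * e b - (x - a) * (b - x) * (y2 - y1) * e2 y3.
  rewrite -mulrA [(y2 - y1) * _]mulrC -e12.
  have -> : e b = e x + e1 y2 * (b - x) by rewrite -ebx; ring.
  have -> : e a = e x - e1 y1 * (x - a) by rewrite -ex; ring.
  by ring.
have e2y : `|e2 y3| <= M by apply: e2M; lra.
have chord_le : (b - a) * `|e x| <= (b - a) * E + (x - a) * (b - x) * (y2 - y1) * M.
  have [bx0 xa0 y21] : [/\ 0 <= b - x, 0 <= x - a & 0 <= y2 - y1] by split; lra.
  have {1}<- : `|b - a| = b - a by rewrite ger0_norm; lra.
  rewrite -normrM chord (le_trans (ler_normB _ _)) // lerD //.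
    rewrite (le_trans (ler_normD _ _)) // !normrM (ger0_norm bx0) (ger0_norm xa0).
    have -> : (b - a) * E = (b - x) * E + (x - a) * E by ring.
    by apply: lerD; exact: ler_wpM2l.
  rewrite !normrM (ger0_norm bx0) (ger0_norm xa0) (ger0_norm y21).
  by apply: ler_wpM2l => //; rewrite !mulr_ge0.
have prod_le : (x - a) * (b - x) * (y2 - y1) * M <= (b - a) * (M / 4 * (b - a) ^+ 2).
  have -> : (b - a) * (M / 4 * (b - a) ^+ 2) = (b - a) ^+ 2 / 4 * (b - a) * M by field.
  apply: ler_wpM2r => //; apply: ler_pM; try by [lra | apply: mulr_ge0; lra].
  by have := sqr_ge0 ((x - a) - (b - x)); nra.
have ba0 : 0 < b - a by lra.
by rewrite -(ler_pM2l ba0) mulrDr; lra.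
Qed.

(** * Second differences of the exact solution *)

Lemma nonvanishing_same_sign (R : realType) (a b : R) (g : R -> R) (y z : R) :
  {within `[a, b], continuous g} ->
  (forall x : R, a <= x <= b -> g x != 0) ->
  a <= y <= b -> a <= z <= b -> 0 < g y * g z.
Proof.
move=> cg g0; wlog yz : y z / y <= z => [H|] yab zab.
  by have [/H|/ltW/H] := leP y z; last rewrite mulrC; apply.
rewrite ltNge; apply/negP => gyz.
have cgyz : {within `[y, z], continuous g}.
  apply: continuous_subspaceW cg => t /=; rewrite !in_itv /= => /andP[? ?].
  by apply/andP; split; lra.
have gyz0 : Num.min (g y) (g z) <= 0 <= Num.max (g y) (g z).
  rewrite ge_min le_max; have [? ?] := (g0 y yab, g0 z zab).
  by case: (ltrgtP (g y) 0) (ltrgtP (g z) 0) => [?|?|?] [?|?|?] //=; nra.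
have [c] := IVT yz cgyz gyz0.
by rewrite in_itv /= => ? gc0; have /eqP := g0 c ltac:(lra).
Qed.

Lemma mean_lower_bound (R : realType) (delta p q : R) :
  delta <= `|p| -> delta <= `|q| -> 0 < p * q -> delta <= `|(p + q) / 2|.
Proof.
have [p0|p0] := leP 0 p; have [q0|q0] := leP 0 q.
- rewrite (ger0_norm p0) (ger0_norm q0) => ? ? _.
  by rewrite ger0_norm; lra.
- by move=> _ _ ?; nra.
- by move=> _ _ ?; nra.
- rewrite (ltr0_norm p0) (ltr0_norm q0) => ? ? _.
  by rewrite ltr0_norm; lra.
Qed.

Lemma within_setX_slicel (R : realType) (A B : set R) (w : R -> R -> R) (t : R) :
  {within A `*` B, continuous (fun p : R * R => w p.1 p.2)} -> B t ->
  {within A, continuous (w^~ t)}.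
Proof.
move=> /subspace_continuousP cw Bt; apply/subspace_continuousP => x Ax.
apply: (@cvg_comp _ _ _ (fun y => (y, t)) (fun p => w p.1 p.2) _
  (within (A `*` B) (nbhs (x, t)))); last exact: cw (x, t) (conj Ax Bt).
move=> P [[U V] /= [Ux Vt] UVP]; apply: filterS Ux => y Uy Ay.
by apply: (UVP (y, t)); split=> //=; exact: nbhs_singleton.
Qed.

Lemma within_setX_slicer (R : realType) (A B : set R) (w : R -> R -> R) (x : R) :
  {within A `*` B, continuous (fun p : R * R => w p.1 p.2)} -> A x ->
  {within B, continuous (w x)}.
Proof.
move=> /subspace_continuousP cw Ax; apply/subspace_continuousP => t Bt.
apply: (@cvg_comp _ _ _ (fun y => (x, y)) (fun p => w p.1 p.2) _
  (within (A `*` B) (nbhs (x, t)))); last exact: cw (x, t) (conj Ax Bt).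
move=> P [[U V] /= [Ux Vt] UVP]; apply: filterS Vt => y Vy By.
by apply: (UVP (x, y)); split=> //=; exact: nbhs_singleton.
Qed.

Lemma class_C2W (R : realType) (k : nat) (A B : set R) (u : R -> R -> R) :
  class_C2 k.+1 A B u -> class_C2 k A B u.
Proof.
elim: k u => [|k IHk] u; first by case.
by move=> [cu [dux dut Cdx Cdt]]; split=> //; split=> //; exact: IHk.
Qed.

(** Both quotients are half of a value of u_xx, at possibly different abscissas
y1 and y0.  The corners (y1, t1), (y0, t1), (y0, t0) are joined by two segments
parallel to the axes, along which u_xx keeps its sign by the intermediate value
theorem; so the two values add up without cancellation. *)
Lemma mean_second_difference_lower_bound (R : realType) (a b t0 t1 x h delta : R)
    (u : R -> R -> R) :
  let I := `[a, b]%classic in let J := `[t0, t1]%classic in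
  t0 <= t1 -> 0 < h -> a <= x - h -> x + h <= b ->
  class_C2 2 I J u -> 0 < delta ->
  (forall y t, I y -> J t -> delta <= `|dx I (dx I u) y t|) ->
  delta <= `|(u (x + h) t1 + u (x - h) t1 - 2 * u x t1) / (2 * h ^+ 2)
             + (u (x + h) t0 + u (x - h) t0 - 2 * u x t0) / (2 * h ^+ 2)|.
Proof.
move=> I J t01 h0 axh xhb [cu [du _ [_ [ddu _ [cuxx _] _]] _]] delta0 uxx_ge.
have itvI y : x - h < y < x + h -> a < y < b by move=> /andP[? ?]; apply/andP; split; lra.
have II y : x - h < y < x + h -> I y.
  by move=> /itvI /andP[? ?]; rewrite /I /= in_itv /=; apply/andP; split; lra.
have second_diff t : J t -> exists2 y : R, x - h < y < x + h &
    u (x + h) t + u (x - h) t - 2 * u x t = h ^+ 2 * dx I (dx I u) y t.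
  move=> Jt.
  apply: (@second_difference_mvt _ (u^~ t) (dx I u ^~ t) (dx I (dx I u) ^~ t)) => //.
  - apply: continuous_subspaceW (within_setX_slicel cu Jt) => y /=.
    by rewrite /I /= !in_itv /= => /andP[? ?]; apply/andP; split; lra.
  - move=> y yh; apply: is_derive_derive_in (itvI _ yh) _.
    exact: du (II _ yh) Jt.
  - move=> y yh; apply: is_derive_derive_in (itvI _ yh) _.
    exact: ddu (II _ yh) Jt.
have Jt0 : J t0 by rewrite /J /= in_itv /= lexx t01.
have Jt1 : J t1 by rewrite /J /= in_itv /= lexx t01.
have [y0 y0h ->] := second_diff t0 Jt0; have [y1 y1h ->] := second_diff t1 Jt1.
have uxx_neq0 y t : I y -> J t -> dx I (dx I u) y t != 0.
  by move=> Iy Jt; rewrite -normr_gt0 (lt_le_trans delta0) // uxx_ge.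
have h2 : h ^+ 2 != 0 by rewrite expf_neq0 // gt_eqF.
have -> p q : h ^+ 2 * p / (2 * h ^+ 2) + h ^+ 2 * q / (2 * h ^+ 2) = (p + q) / 2.
  by field; rewrite gt_eqF.
apply: mean_lower_bound; try by apply: uxx_ge => //; exact: II.
have Iy0 := II _ y0h; have Iy1 := II _ y1h.
have sign_x : 0 < dx I (dx I u) y1 t1 * dx I (dx I u) y0 t1.
  apply: (nonvanishing_same_sign (within_setX_slicel cuxx Jt1)) => [y yab||].
  - by apply: uxx_neq0 => //; rewrite /I /= in_itv.
  - by move: Iy1; rewrite /I /= in_itv.
  - by move: Iy0; rewrite /I /= in_itv.
have sign_t : 0 < dx I (dx I u) y0 t1 * dx I (dx I u) y0 t0.
  apply: (nonvanishing_same_sign (within_setX_slicer cuxx Iy0)) => [t t01'||].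
  - by apply: uxx_neq0 => //; rewrite /J /= in_itv.
  - by move: Jt1; rewrite /J /= in_itv.
  - by move: Jt0; rewrite /J /= in_itv.
have corner2 : 0 < dx I (dx I u) y0 t1 ^+ 2.
  by rewrite exprn_even_gt0 //= uxx_neq0.
rewrite -(pmulr_lgt0 _ corner2).
have -> p q s : p * s * q ^+ 2 = (p * q) * (q * s) :> R by ring.
exact: mulr_gt0.
Qed.

(** * Differentiability of the network *)

(** The derivatives are kept as explicit witnesses on the whole line, so that
the chain and product rules compose without any local analysis. *)
Definition twice_derivable (R : realType) (g : R -> R) : Prop :=
  exists g1 g2 : R -> R, forall x : R, is_derive x 1 g (g1 x) /\ is_derive x 1 g1 (g2 x).

Lemma twice_derivable_cst (R : realType) (c : R) : twice_derivable (fun=> c).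
Proof. by exists (fun=> 0), (fun=> 0) => x; split; exact: is_derive_cst. Qed.

Lemma twice_derivable_id (R : realType) : twice_derivable (fun x : R => x).
Proof.
by exists (fun=> 1), (fun=> 0) => x; split; [exact: is_derive_id|exact: is_derive_cst].
Qed.

Lemma twice_derivableD (R : realType) (f g : R -> R) :
  twice_derivable f -> twice_derivable g -> twice_derivable (fun x => f x + g x).
Proof.
move=> [f1 [f2 df]] [g1 [g2 dg]].
exists (fun x => f1 x + g1 x), (fun x => f2 x + g2 x) => x.
by have [[? ?] [? ?]] := (df x, dg x); split; exact: is_deriveD.
Qed.

Lemma twice_derivableZ (R : realType) (c : R) (f : R -> R) :
  twice_derivable f -> twice_derivable (fun x => c * f x).
Proof.
move=> [f1 [f2 df]]; exists (fun x => c * f1 x), (fun x => c * f2 x) => x.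
by have [? ?] := df x; split; exact: is_deriveZ.
Qed.

Lemma twice_derivable_sum (R : realType) (n : nat) (f : 'I_n -> R -> R) :
  (forall i, twice_derivable (f i)) -> twice_derivable (fun x => \sum_(i < n) f i x).
Proof.
elim: n f => [|n IHn] f df.
  under eq_fun do rewrite big_ord0.
  exact: twice_derivable_cst.
under eq_fun do rewrite big_ord_recr /=.
by apply: twice_derivableD => //; apply: IHn.
Qed.

Lemma is_derive_tanh (R : realType) (z : R) :
  is_derive z 1 (@tanh R) (1 - tanh z ^+ 2).
Proof.
pose ep := @expR R; pose em := fun y : R => expR (- y).
have dep : is_derive z 1 ep (ep z) by exact: is_derive_expR.
have dem : is_derive z 1 em (- em z).
  rewrite -mulrN1.
  exact: (is_derive1_comp (is_derive_expR (- z)) (is_deriveNid z 1)).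
have den0 : (ep + em) z != 0 by rewrite gt_eqF // addr_gt0 // expR_gt0.
have dnum := is_deriveB dep dem; have dden := is_deriveD dep dem.
have := is_deriveM dnum (is_deriveV den0 dden).
rewrite (_ : _ * _ = @tanh R) // => dtanh; apply: (is_derive_eq dtanh).
(* The library operations reach the goal through several structures on R, which
   only conversion identifies: the identity is proved on plain reals first. *)
have quotient_rule (p q : R) : p + q != 0 ->
    (p - q) * (- (p + q) ^- 2 * (p - q)) + (p + q)^-1 * (p - - q)
    = 1 - ((p - q) / (p + q)) ^+ 2.
  by move=> pq0; field.
exact: quotient_rule den0.
Qed.

Lemma twice_derivable_tanh (R : realType) (g : R -> R) :
  twice_derivable g -> twice_derivable (fun x => tanh (g x)).
Proof.
move=> [g1 [g2 dg]].
exists (fun x => (1 - tanh (g x) ^+ 2) * g1 x).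
exists (fun x => (1 - tanh (g x) ^+ 2) * g2 x
                 - 2 * tanh (g x) * (1 - tanh (g x) ^+ 2) * g1 x ^+ 2) => x.
have [dgx dg1x] := dg x.
have dtg := is_derive1_comp (is_derive_tanh (g x)) dgx.
split=> //.
have dsq := is_deriveM dtg dtg.
have done_ := is_deriveB (is_derive_cst (1 : R) x 1) dsq.
have := is_deriveM done_ dg1x.
rewrite (_ : _ * _ = fun y => (1 - tanh (g y) ^+ 2) * g1 y); last first.
  by apply/funext => y /=; rewrite expr2.
move=> dprod; apply: (is_derive_eq dprod).
have product_rule (s a b : R) :
    (1 - s ^+ 2) * b + a * (0 - (s * ((1 - s ^+ 2) * a) + s * ((1 - s ^+ 2) * a)))
    = (1 - s ^+ 2) * b - 2 * s * (1 - s ^+ 2) * a ^+ 2.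
  by ring.
exact: product_rule.
Qed.

(** Coordinatewise, each layer is an affine combination of the previous one
followed by tanh. *)
Lemma eval_net_twice_derivable (R : realType) (theta : network R) :
  twice_derivable (eval_net theta).
Proof.
have affine (p q : nat) (A : 'M[R]_(p, q)) (b : 'cV[R]_p) (y : R -> 'cV[R]_q) (i : 'I_p) :
    (forall j, twice_derivable (fun x => y x j 0)) ->
    twice_derivable (fun x => (A *m y x + b) i 0).
  move=> dy.
  under eq_fun do rewrite !mxE.
  apply: twice_derivableD; last exact: twice_derivable_cst.
  by apply: twice_derivable_sum => j; apply: twice_derivableZ.
have layerP j i : twice_derivable (fun x => layer theta x j i 0).
  elim: j i => [|j IHj] i /=; under eq_fun do rewrite mxE;
    apply: twice_derivable_tanh; apply: affine => // k.
  under eq_fun do rewrite mxE (ord1 k) eqxx mulr1n.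
  exact: twice_derivable_id.
by apply: affine => j; exact: layerP.
Qed.

Lemma derive1n2E (R : realType) (g g1 g2 : R -> R) :
  (forall x : R, is_derive x 1 g (g1 x)) -> (forall x : R, is_derive x 1 g1 (g2 x)) ->
  derive1n 2 g = g2.
Proof.
move=> dg dg1; have g1E : g^`()%classic = g1.
  by apply/funext => x; rewrite derive1E; have [] := dg x.
by rewrite /= g1E; apply/funext => x; rewrite derive1E; have [] := dg1 x.
Qed.

(** * Residuals and nodes *)

(** The residual is affine in the coefficient and linear in the data, so the
difference of the two residuals isolates (a - b) times the second difference
quotient of the noiseless data, plus the residual of the noise with coefficient a.
In the latter the time difference costs 2 eps_o / tau, and each of the two second
differences 4 eps_o / (2 h^2). *)
Lemma cn_coefficient_error (R : realType) (n : nat) (tau h a b F0 delta : R)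
    (eps_a eps_b eps_o : R) (v0 v1 w0 w1 : 'rV[R]_n) (l i r : 'I_n) :
  0 < tau -> 0 < h -> `|a| <= F0 ->
  (forall j, `|w0 0 j| <= eps_o) -> (forall j, `|w1 0 j| <= eps_o) ->
  `|cn_residual tau h a (v0 + w0) (v1 + w1) l i r| <= eps_a ->
  `|cn_residual tau h b v0 v1 l i r| <= eps_b ->
  delta <= `|(v1 0 r + v1 0 l - 2 * v1 0 i) / (2 * h ^+ 2)
             + (v0 0 r + v0 0 l - 2 * v0 0 i) / (2 * h ^+ 2)| ->
  delta * `|a - b| <= eps_a + eps_b + 2 * (1 / tau + 2 * F0 / h ^+ 2) * eps_o.
Proof.
move=> tau0 h0 aF0 w0_le w1_le; rewrite /cn_residual !mxE.
have h2 : 0 < h ^+ 2 by rewrite exprn_gt0.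
set ra := (X in `|X| <= eps_a); set rb := (X in `|X| <= eps_b).
set A := (X in delta <= `|X|) => res_a res_b A_ge.
pose B := (w1 0 r + w1 0 l - 2 * w1 0 i) / (2 * h ^+ 2)
          + (w0 0 r + w0 0 l - 2 * w0 0 i) / (2 * h ^+ 2).
have errE : (a - b) * A = rb - ra + (w1 0 i - w0 0 i) / tau - a * B.
  by rewrite /ra /rb /A /B; field; rewrite !gt_eqF.
have [eo0 F00] : 0 <= eps_o /\ 0 <= F0.
  by split; [apply: le_trans (w0_le i) | apply: le_trans aF0].
have tauV0 : 0 < tau^-1 by rewrite invr_gt0.
have time_le : `|(w1 0 i - w0 0 i) / tau| <= 2 * eps_o / tau.
  rewrite normrM (gtr0_norm tauV0) ler_pM2r // (le_trans (ler_normB _ _)) //.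
  by rewrite mulr2n mulrDl mul1r lerD.
have second_diff_le (w : 'rV[R]_n) : (forall j, `|w 0 j| <= eps_o) ->
    `|(w 0 r + w 0 l - 2 * w 0 i) / (2 * h ^+ 2)| <= 2 * eps_o / h ^+ 2.
  move=> w_le; have [wr wl wi] := And3 (w_le r) (w_le l) (w_le i).
  have -> : 2 * eps_o / h ^+ 2 = 4 * eps_o / (2 * h ^+ 2) by field; rewrite gt_eqF.
  have hV0 : 0 < (2 * h ^+ 2)^-1 by rewrite invr_gt0 mulr_gt0.
  rewrite normrM (gtr0_norm hV0) ler_pM2r //.
  move: wr wl wi; rewrite !ler_norml => /andP[? ?] /andP[? ?] /andP[? ?].
  by apply/andP; split; lra.
have B_le : `|a * B| <= F0 * (4 * eps_o / h ^+ 2).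
  rewrite normrM ler_pM // (le_trans (ler_normD _ _)) //.
  have -> : 4 * eps_o / h ^+ 2 = 2 * eps_o / h ^+ 2 + 2 * eps_o / h ^+ 2.
    by field; rewrite gt_eqF.
  by rewrite lerD // second_diff_le.
have err_le : `|a - b| * `|A| <= eps_b + eps_a + 2 * eps_o / tau + F0 * (4 * eps_o / h ^+ 2).
  rewrite -normrM errE (le_trans (ler_normB _ _)) // lerD //.
  rewrite (le_trans (ler_normD _ _)) // lerD // (le_trans (ler_normB _ _)) //.
  exact: lerD.
have -> : eps_a + eps_b + 2 * (1 / tau + 2 * F0 / h ^+ 2) * eps_o
    = eps_b + eps_a + 2 * eps_o / tau + F0 * (4 * eps_o / h ^+ 2).
  by field; rewrite !gt_eqF.
by apply: le_trans err_le; rewrite mulrC ler_wpM2l.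
Qed.

Lemma row_entry_le_norm (R : realType) (n : nat) (w : 'rV[R]_n) (c : R) :
  `|w| <= c -> forall j, `|w 0 j| <= c.
Proof.
move=> wc j; apply: le_trans wc; rewrite /Num.Def.normr /= mx_normrE.
exact: (le_bigmax 0 (fun ij : 'I_1 * 'I_n => `|w ij.1 ij.2|) (0, j)).
Qed.

Lemma mesh_gt0 (R : realType) (n : nat) : (1 < n)%N -> 0 < mesh R n.
Proof. by move=> n1; rewrite divr_gt0 // subr_gt0 ltr1n. Qed.

Lemma mesh_mul (R : realType) (n : nat) : (1 < n)%N -> (n%:R - 1) * mesh R n = 2.
Proof. by move=> n1; rewrite mulrC divfK // subr_eq0 pnatr_eq1 gtn_eqF. Qed.

(** Both nodes around x must be interior, since the residuals only control these.
The case of a node is separate because x = 1 - h is the last interior node and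
has no interior node to its right. *)
Lemma grid_bracket (R : realType) (n : nat) (x : R) :
  (2 < n)%N -> -1 + mesh R n <= x <= 1 - mesh R n ->
  exists k, [/\ (0 < k)%N, (k.+1 < n)%N &
    x = -1 + k%:R * mesh R n \/
    (k.+2 < n)%N /\ -1 + k%:R * mesh R n < x < -1 + k.+1%:R * mesh R n].
Proof.
move=> n3; set h := mesh R n => /andP[xl xr].
have h0 : 0 < h by apply: mesh_gt0; exact: ltnW.
have nh : (n%:R - 1) * h = 2 by apply: mesh_mul; exact: ltnW.
have s0 : 0 <= (x + 1) / h by rewrite divr_ge0 //; lra.
have /andP[] := truncn_itv s0; set k := Num.trunc _.
rewrite ler_pdivlMr // ltr_pdivrMr // => kx xk.
have k0 : (0 < k)%N.
  by rewrite -ltnS -(ltr_nat R) -(ltr_pM2r h0); lra.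
have kn : (k.+1 < n)%N.
  rewrite -(ltr_nat R) -natr1 -ltrBrDr -(ltr_pM2r h0) nh.
  by lra.
exists k; split => //.
have [xE|xE] := eqVneq x (-1 + k%:R * h); [by left|right].
have kx' : -1 + k%:R * h < x by rewrite lt_neqAle eq_sym xE /=; lra.
split; last by apply/andP; split; lra.
rewrite -(ltr_nat R) -2!natr1 -ltrBrDr -(ltr_pM2r h0) nh mulrDl.
by lra.
Qed.

(** * The error estimate *)

Lemma error_bound_explicit (R : realType)
    (C1 delta F0 F2 F2f tau h eps_opt eps_c eps_o err : R) :
  0 < delta -> 0 <= F2 -> 0 <= F2f -> eps_c <= C1 * (tau ^+ 2 + h ^+ 2) ->
  let nodal := (eps_opt + eps_c + 2 * (1 / tau + 2 * F0 / h ^+ 2) * eps_o) / delta in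
  0 <= nodal -> err <= nodal + (F2 + F2f) / 4 * h ^+ 2 ->
  err <= 2 * C1 / delta * tau ^+ 2
         + (2 * C1 / delta + (F2 + F2f) / 2) * h ^+ 2
         + 2 / delta * eps_opt
         + 4 / delta * (1 / tau + 2 * F0 / h ^+ 2) * eps_o.
Proof.
move=> delta0 F20 F2f0 ec_le nodal nodal0 err_le; rewrite /nodal in nodal0 err_le *.
set noise := (1 / tau + _) in nodal0 err_le *.
have ec_le' : eps_c / delta <= C1 * (tau ^+ 2 + h ^+ 2) / delta.
  by rewrite ler_pM2r // invr_gt0.
have curv0 : 0 <= (F2 + F2f) * h ^+ 2 by rewrite mulr_ge0 ?sqr_ge0 // addr_ge0.
have nodalE : (eps_opt + eps_c + 2 * noise * eps_o) / delta
    = eps_opt / delta + eps_c / delta + 2 * noise * eps_o / delta by ring.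
have -> : 2 * C1 / delta * tau ^+ 2 + (2 * C1 / delta + (F2 + F2f) / 2) * h ^+ 2
      + 2 / delta * eps_opt + 4 / delta * noise * eps_o
    = 2 * (C1 * (tau ^+ 2 + h ^+ 2) / delta + eps_opt / delta
           + 2 * noise * eps_o / delta) + (F2 + F2f) * h ^+ 2 / 2.
  by ring.
have curvE : (F2 + F2f) / 4 * h ^+ 2 = (F2 + F2f) * h ^+ 2 / 4 by ring.
move: nodal0 err_le; rewrite nodalE curvE; move: ec_le' curv0.
move: (eps_c / delta) (C1 * _ / delta) ((F2 + F2f) * _) (eps_opt / delta) => a b c d.
by move: (_ * eps_o / delta) => e; lra.
Qed.

(** The constant is the sum of the coefficients, so that it dominates each of
them; 1 + 2 F0 covers at once the noise terms in 1/tau and in 1/h^2. *)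
Lemma error_bound_bigO (R : realType)
    (C1 delta F0 F2 F2f tau h eps_opt eps_o : R) :
  0 <= C1 -> 0 < delta -> 0 <= F0 -> 0 <= F2 -> 0 <= F2f ->
  0 < tau -> 0 < h -> 0 <= eps_opt -> 0 <= eps_o ->
  2 * C1 / delta * tau ^+ 2
    + (2 * C1 / delta + (F2 + F2f) / 2) * h ^+ 2
    + 2 / delta * eps_opt
    + 4 / delta * (1 / tau + 2 * F0 / h ^+ 2) * eps_o
  <= (2 * C1 / delta + (F2 + F2f) / 2 + 2 / delta + 4 / delta * (1 + 2 * F0))
     * (tau ^+ 2 + h ^+ 2 + eps_opt + (1 / tau + 1 / h ^+ 2) * eps_o).
Proof.
move=> C10 delta0 F00 F20 F2f0 tau0 h0 eopt0 eo0.
have dV : 0 <= delta^-1 by rewrite invr_ge0 ltW.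
have c1 : 0 <= 2 * C1 / delta by rewrite !mulr_ge0.
have c2 : 0 <= (F2 + F2f) / 2 by rewrite divr_ge0 // addr_ge0.
have c3 : 0 <= 2 / delta by rewrite mulr_ge0.
have c4 : 0 <= 4 / delta by rewrite mulr_ge0.
have c5 : 0 <= 4 / delta * (2 * F0) by rewrite !mulr_ge0.
have tV : 0 <= 1 / tau by rewrite mulr_ge0 // invr_ge0 ltW.
have hV : 0 <= 1 / h ^+ 2 by rewrite mulr_ge0 // invr_ge0 ltW // exprn_gt0.
rewrite 3![in leRHS]mulrDr; apply: lerD; first apply: lerD; first apply: lerD.
- by apply: ler_wpM2r; [exact: sqr_ge0 | lra].
- by apply: ler_wpM2r; [exact: sqr_ge0 | lra].
- by apply: ler_wpM2r => //; lra.
rewrite [in leRHS]mulrA; apply: ler_wpM2r => //.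
have -> : 4 / delta * (1 / tau + 2 * F0 / h ^+ 2)
    = 4 / delta * (1 / tau) + 4 / delta * (2 * F0) * (1 / h ^+ 2) by ring.
rewrite [in leRHS]mulrDr; apply: lerD; apply: ler_wpM2r => //; lra.
Qed.

Theorem theorem6 (R : realType) (C1 delta2 F0 F2 F2f : R)
    (C1_gt0 : 0 < C1) (delta2_gt0 : 0 < delta2) (F0_gt0 : 0 < F0)
    (F2_gt0 : 0 < F2) :
  exists2 K : R, 0 < K &
  forall (T t0 t1 : R) (n : nat) (f phim phip uinit : R -> R)
    (u : R -> R -> R) (W0 W1 : 'rV[R]_n) (theta : network R)
    (C eps_c eps_o eps_opt delta4 : R),
  let tau := t1 - t0 in
  let h := mesh R n in
  let I : set R := `[-1, 1]%classic in
  let J : set R := `[t0, t1]%classic in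
  let u0 := sample n u t0 in
  let u1 := sample n u t1 in
  let U0 := u0 + W0 in
  let U1 := u1 + W1 in
  let ftheta := eval_net theta in
  0 < T -> 0 <= t0 -> t0 < t1 -> t1 <= T -> (3 <= n)%N ->
  exact_solution T f phim phip uinit u ->
  0 < C -> params_bounded theta C ->
  (* observation error *)
  0 < eps_o -> `|W0| <= eps_o -> `|W1| <= eps_o ->
  (* optimization error *)
  0 < eps_opt -> cn_residual_le tau h ftheta U0 U1 eps_opt ->
  (* bounds on the network *)
  (forall x, I x -> `|ftheta x| <= F0) ->
  (forall x, I x -> `|derive1n 2 ftheta x| <= F2) ->
  (* regularity of the solution and of the coefficient *)
  class_C2 4 I J u ->
  is_min [set `|iter 2 (dx I) u p.1 p.2| | p in I `*` J] delta2 ->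
  is_max [set `|iter 4 (dx I) u p.1 p.2| | p in I `*` J] delta4 ->
  class_C 2 I f ->
  is_max [set `|iter 2 (derive_in I) f x| | x in I] F2f ->
  (* mesh restriction *)
  (delta4 != 0 -> h < Num.sqrt (6 * delta2 / delta4)) ->
  (* consistency of the Crank-Nicolson scheme on the exact solution *)
  cn_residual_le tau h f u0 u1 eps_c ->
  eps_c <= C1 * (tau ^+ 2 + h ^+ 2) ->
  forall x : R, -1 + h <= x <= 1 - h ->
    `|ftheta x - f x| <=
        2 * C1 / delta2 * tau ^+ 2
        + (2 * C1 / delta2 + (F2 + F2f) / 2) * h ^+ 2
        + 2 / delta2 * eps_opt
        + 4 / delta2 * (1 / tau + 2 * F0 / h ^+ 2) * eps_o
    /\
    `|ftheta x - f x| <=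
        K * (tau ^+ 2 + h ^+ 2 + eps_opt + (1 / tau + 1 / h ^+ 2) * eps_o).
Proof.
(* F2f is a maximum of absolute values, but this is only known once f is given;
   the absolute value keeps the constant positive before that. *)
exists (2 * C1 / delta2 + (F2 + `|F2f|) / 2 + 2 / delta2
        + 4 / delta2 * (1 + 2 * F0)).
  have dV : 0 < delta2^-1 by rewrite invr_gt0.
  have [p1 p2] : 0 < C1 / delta2 /\ 0 < F0 / delta2 by split; exact: divr_gt0.
  by have := normr_ge0 F2f; lra.
move=> T t0 t1 n f phim phip uinit u W0 W1 theta C eps_c eps_o eps_opt delta4.
move=> tau h I J u0 u1 U0 U1 ftheta _ _ t01 _ n3 _ _ _ eo0 W0_le W1_le eopt0.
move=> res_theta ftheta_le ftheta2_le Cu [_ uxx_ge] _ Cf [_ f2_le] _ res_f ec_le.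
move=> x xh.
have tau0 : 0 < tau by rewrite subr_gt0.
have h0 : 0 < h by apply: mesh_gt0; exact: ltnW.
have nh : (n%:R - 1) * h = 2 by apply: mesh_mul; exact: ltnW.
pose node k : R := -1 + k%:R * h.
(* [node] extends [grid] to all natural indices, and [rhs / delta2] bounds the error
   at the interior ones. *)
pose rhs := eps_opt + eps_c + 2 * (1 / tau + 2 * F0 / h ^+ 2) * eps_o.
have node_itv k : (0 < k)%N -> (k.+1 < n)%N -> -1 + h <= node k <= 1 - h.
  rewrite -(ltr_nat R) -[(k.+1 < n)%N]/(k.+2 <= n)%N -(ler_nat R) -2!natr1.
  move=> k0 kn; have k1 : 1 <= k%:R :> R by rewrite ler1n -(ltr_nat R).
  rewrite /node; have : (k%:R + 1 + 1) * h <= n%:R * h by rewrite ler_pM2r.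
  have : 1 * h <= k%:R * h by rewrite ler_pM2r.
  by lra.
have node_error k : (0 < k)%N -> (k.+1 < n)%N ->
    `|ftheta (node k) - f (node k)| <= rhs / delta2.
  move=> k0 kn; have /andP[kl kr] := node_itv k k0 kn.
  have lt_pred : (k.-1 < n)%N by apply: leq_ltn_trans (leq_pred k) (ltnW kn).
  pose l := Ordinal lt_pred; pose i := Ordinal (ltnW kn); pose r := Ordinal kn.
  have li : i = l.+1 :> nat by rewrite /= prednK.
  have gridi : grid R i = node k by [].
  have gridl : grid R l = node k - h.
    by rewrite /grid /node -[in RHS](prednK k0) -natr1 -/h; ring.
  have gridr : grid R r = node k + h by rewrite /grid /node /= -natr1 -/h; ring.
  rewrite ler_pdivlMr // mulrC.
  apply: (cn_coefficient_error tau0 h0 _ (row_entry_le_norm W0_le)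
    (row_entry_le_norm W1_le) (res_theta l i r li erefl) (res_f l i r li erefl)).
    by apply: ftheta_le; rewrite gridi /I /= in_itv /=; apply/andP; split; lra.
  rewrite !mxE gridl gridr gridi.
  apply: (mean_second_difference_lower_bound (a := -1) (b := 1) (ltW t01)) => //.
  - by lra.
  - by lra.
  - exact: class_C2W (class_C2W Cu).
  by move=> y t Iy Jt; apply: uxx_ge; exists (y, t).
have [g1 [g2 dg]] := eval_net_twice_derivable theta.
have g2E := derive1n2E (fun y => (dg y).1) (fun y => (dg y).2).
have [_ [df [_ [df1 _]]]] := Cf.
pose f1 := derive_in I f; pose f2 := derive_in I f1.
have II y : -1 < y < 1 -> I y.
  by move=> /andP[? ?]; rewrite /I /= in_itv /=; apply/andP; split; lra.
have F2f0 : 0 <= F2f.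
  by apply: le_trans (f2_le `|f2 0| _) => //; exists 0 => //; apply: II; lra.
have error_le : `|ftheta x - f x| <= rhs / delta2 + (F2 + F2f) / 4 * h ^+ 2.
  have [k [k0 kn xk]] := grid_bracket n3 xh.
  have knode := node_itv k k0 kn.
  have F2F2f0 : 0 <= (F2 + F2f) / 4 * h ^+ 2.
    by rewrite mulr_ge0 ?sqr_ge0 // divr_ge0 // addr_ge0 // ltW.
  case: xk => [->|[kn2 xk]]; first by rewrite -/(node k); have := node_error k k0 kn; lra.
  have k1node := node_itv k.+1 isT kn2.
  have itv_node y : node k <= y <= node k.+1 -> -1 < y < 1.
    by move=> /andP[? ?]; move/andP: knode => [? ?]; move/andP: k1node => [? ?];
      apply/andP; split; lra.
  have -> : h = node k.+1 - node k by rewrite /node -natr1; ring.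
  apply: (@between_nodes_bound _ (ftheta - f) (g1 - f1) (g2 - f2) _ _ _ _ _ xk).
  - move=> y /itv_node y1; apply: is_deriveB; first exact: (dg y).1.
    by apply: is_derive_derive_in => //; exact: df (II _ y1).
  - move=> y /itv_node y1; apply: is_deriveB; first exact: (dg y).2.
    by apply: is_derive_derive_in => //; exact: df1 (II _ y1).
  - move=> y /itv_node y1; apply: le_trans (ler_normB _ _) _; apply: lerD.
      by rewrite -g2E; apply: ftheta2_le; exact: II.
    by apply: f2_le; exists y => //; exact: II.
  - exact: node_error.
  - exact: node_error.
have rhs0 : 0 <= rhs / delta2.
  by apply: le_trans (node_error 1%N isT n3); exact: normr_ge0.
have explicit := error_bound_explicit delta2_gt0 (ltW F2_gt0) F2f0 ec_le rhs0 error_le.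
split; first exact: explicit.
apply: le_trans explicit _; rewrite (ger0_norm F2f0).
by apply: error_bound_bigO => //; exact: ltW.
Qed.
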